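(* Let $(A,B)$ be a $\mathbb K$-balanced pair of bounded operators on a Hilbert space $H$. For any $\varepsilon>0$ there exists an orthogonal decomposition $H=H_1\oplus H_2$ into closed subspaces such that, writing operators on $H$ as $2\times 2$ matrices $(T_{ij})$ with respect to this decomposition: (1) $\|A_{ij}-B_{ij}\|<\varepsilon$ for any $(i,j)\neq(1,1)$; (2) for each of the four operators $C=1-A^*A,\ 1-AA^*,\ 1-B^*B,\ 1-BB^*$ and any $(i,j)\neq(2,2)$, the entry $C_{ij}$ is of the form $D+K$ with $\|D\|<\varepsilon$ and $K$ compact.
   Context: For a bounded operator $T$ on $H$, $\dot T$ denotes its class in the Calkin algebra $\mathbb B(H)/\mathbb K(H)$. A pair $(a,b)$ of contractions (elements of norm $\le 1$) in a $C^*$-algebra is balanced if $(a-b)c=0$ and $(a^*-b^* )c=0$ for every $c\in\{1-a^*a,\ 1-aa^*,\ 1-b^*b,\ 1-bb^*\}$. A pair $(A,B)$ of bounded operators on $H$ is $\mathbb K$-balanced (balanced modulo compacts) if $(\dot A,\dot B)$ is a balanced pair in the Calkin algebra. *)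

(* Defs.v *)
From HB Require Import structures.
From mathcomp Require Import all_boot all_order all_algebra.
From mathcomp Require Import generic_quotient.
From mathcomp Require Import all_classical all_reals all_analysis.
From mathcomp Require Import complex.
Set Implicit Arguments.
Unset Strict Implicit.
Unset Printing Implicit Defensive.
Import Order.TTheory GRing.Theory Num.Theory.
Import numFieldNormedType.Exports.
Local Open Scope classical_set_scope.
Local Open Scope ring_scope.
Local Open Scope complex_scope.

(* Complex Hilbert spaces; the inner product is linear in its first argument. *)
HB.mixin Record CompleteNormedModule_isHilbert (R : realType) H
    & CompleteNormedModule R[i] H := {
  inner : H -> H -> R[i] ;
  innerPl : forall a x y z, inner (a *: x + y) z = a * inner x z + inner y z ;
  inner_conj : forall x y, inner y x = Num.conj (inner x y) ;
  inner_norm : forall x, inner x x = `|x| ^+ 2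
}.

#[short(type="hilbertType")]
HB.structure Definition Hilbert (R : realType) :=
  {H of CompleteNormedModule R[i] H & CompleteNormedModule_isHilbert R H}.

Section BoundedOperators.
Variable R : realType.

Record bop (U V : hilbertType R) := Bop {
  bop_fun :> U -> V ;
  bop_linear : linear bop_fun ;
  bop_bounded : exists M : R[i], forall x, `|bop_fun x| <= M * `|x|
}.

HB.instance Definition _ (U V : hilbertType R) (T : bop U V) :=
  GRing.isLinear.Build R[i] U V *:%R (bop_fun T) (bop_linear T).

HB.instance Definition _ (U V : hilbertType R) := gen_eqMixin (bop U V).
HB.instance Definition _ (U V : hilbertType R) := gen_choiceMixin (bop U V).

Lemma bopP (U V : hilbertType R) (S T : bop U V) : S =1 T -> S = T.
Proof.
case: S T => [s sl sb] [t tl tb] /= /funext st; rewrite st in sl sb *.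
by congr Bop; exact: Prop_irrelevance.
Qed.

Lemma bop_boundW (U V : hilbertType R) (T : bop U V) :
  exists M : R[i], 0 < M /\ forall x, `|T x| <= M * `|x|.
Proof.
have [M TM] := bop_bounded T; exists (`|M| + 1); split; first by rewrite ltr_wpDl.
move=> x; have [->|x0] := eqVneq x 0; first by rewrite linear0 !normr0 mulr0.
have xp : 0 < `|x| by rewrite normr_gt0.
have M0 : 0 <= M.
  by rewrite -(pmulr_lge0 _ xp); exact: le_trans (TM x).
by apply: (le_trans (TM x)); rewrite ler_pM2r// (ger0_norm M0) lerDl.
Qed.

Lemma bop_continuous (U V : hilbertType R) (T : bop U V) : continuous T.
Proof.
have [M [M0 TM]] := bop_boundW T.
apply/bounded_linear_continuous/linear_boundedP.
exists M; split; first exact: gtr0_real.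
move=> r Mr x; apply: (le_trans (TM x)); apply: ler_wpM2r => //; exact: ltW.
Qed.

Section Ops.
Variables U V W : hilbertType R.

Lemma bop0_linear : linear (fun _ : U => 0 : V).
Proof. by move=> a x y; rewrite scaler0 addr0. Qed.
Lemma bop0_bounded : exists M : R[i], forall x : U, `|0 : V| <= M * `|x|.
Proof. by exists 0 => x; rewrite normr0 mul0r. Qed.
Definition bop0 := Bop bop0_linear bop0_bounded.

Lemma bop_opp_linear (T : bop U V) : linear (fun x => - T x).
Proof. by move=> a x y; rewrite linearP opprD scalerN. Qed.
Lemma bop_opp_bounded (T : bop U V) :
  exists M : R[i], forall x, `|- T x| <= M * `|x|.
Proof. by have [M TM] := bop_bounded T; exists M => x; rewrite normrN. Qed.
Definition bop_opp T := Bop (bop_opp_linear T) (bop_opp_bounded T).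

Lemma bop_add_linear (S T : bop U V) : linear (fun x => S x + T x).
Proof. by move=> a x y; rewrite !linearP scalerDr addrACA. Qed.
Lemma bop_add_bounded (S T : bop U V) :
  exists M : R[i], forall x, `|S x + T x| <= M * `|x|.
Proof.
have [[M SM] [N TN]] := (bop_bounded S, bop_bounded T); exists (M + N) => x.
by rewrite mulrDl; apply: (le_trans (ler_normD _ _)); exact: lerD.
Qed.
Definition bop_add S T := Bop (bop_add_linear S T) (bop_add_bounded S T).

Lemma bop_comp_linear (S : bop V W) (T : bop U V) : linear (fun x => S (T x)).
Proof. by move=> a x y; rewrite !linearP. Qed.
Lemma bop_comp_bounded (S : bop V W) (T : bop U V) :
  exists M : R[i], forall x, `|S (T x)| <= M * `|x|.
Proof.
have [[M [M0 SM]] [N TN]] := (bop_boundW S, bop_bounded T).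
exists (M * N) => x; apply: (le_trans (SM _)).
by rewrite -mulrA ler_pM2l.
Qed.
Definition bop_comp S T := Bop (bop_comp_linear S T) (bop_comp_bounded S T).

Lemma bop_id_bounded : exists M : R[i], forall x : U, `|x| <= M * `|x|.
Proof. by exists 1 => x; rewrite mul1r. Qed.
Definition bop_id : bop U U := @Bop U U id (fun _ _ _ => erefl) bop_id_bounded.

End Ops.

Section Zmod.
Variables U V : hilbertType R.
Lemma bop_addA : associative (@bop_add U V).
Proof. by move=> S T L; apply: bopP => x /=; rewrite addrA. Qed.
Lemma bop_addC : commutative (@bop_add U V).
Proof. by move=> S T; apply: bopP => x /=; rewrite addrC. Qed.
Lemma bop_add0 : left_id (bop0 U V) (@bop_add U V).
Proof. by move=> T; apply: bopP => x /=; rewrite add0r. Qed.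
Lemma bop_addN : left_inverse (bop0 U V) (@bop_opp U V) (@bop_add U V).
Proof. by move=> T; apply: bopP => x /=; rewrite addNr. Qed.
HB.instance Definition _ :=
  GRing.isZmodule.Build (bop U V) bop_addA bop_addC bop_add0 bop_addN.
End Zmod.

Section Ring.
Variable H : hilbertType R.
Lemma bop_mulA : associative (@bop_comp H H H).
Proof. by move=> S T L; exact: bopP. Qed.
Lemma bop_mul1 : left_id (bop_id H) (@bop_comp H H H).
Proof. by move=> T; exact: bopP. Qed.
Lemma bop_mulr1 : right_id (bop_id H) (@bop_comp H H H).
Proof. by move=> T; exact: bopP. Qed.
Lemma bop_mulDl : left_distributive (@bop_comp H H H) +%R.
Proof. by move=> S T L; exact: bopP. Qed.
Lemma bop_mulDr : right_distributive (@bop_comp H H H) +%R.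
Proof. by move=> S T L; apply: bopP => x /=; rewrite linearD. Qed.
HB.instance Definition _ := GRing.Zmodule_isPzRing.Build (bop H H)
  bop_mulA bop_mul1 bop_mulr1 bop_mulDl bop_mulDr.
End Ring.

(* Norms of [normedModType R[i]] take their (real) values in R[i]. *)
Definition opnorm (U V : hilbertType R) (T : bop U V) : R :=
  sup [set complex.Re `|T x| | x in [set x : U | `|x| <= 1]].

(* The adjoint exists and is unique by the Riesz representation theorem, so
   that the default value 0 is never used. *)
Definition adjoint (H : hilbertType R) (T : bop H H) : bop H H :=
  xget 0 [set S : bop H H | forall x y, inner (T x) y = inner x (S y)].

Definition compact_op (U V : hilbertType R) (T : bop U V) : Prop :=
  precompact (T @` [set x : U | `|x| <= 1]).

Lemma precompact_sub (U : hilbertType R) (A K : set U) :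
  compact K -> A `<=` K -> precompact A.
Proof.
move=> cK AK; apply: (precompact_subset AK).
by rewrite precompact_closed//; apply: compact_closed => //; exact: norm_hausdorff.
Qed.

Lemma compact_op0 (U V : hilbertType R) : compact_op (0 : bop U V).
Proof.
apply: (@precompact_sub _ _ [set 0]); first exact: compact_set1.
by move=> _ [x _ <-].
Qed.

Lemma compact_opN (U V : hilbertType R) (T : bop U V) :
  compact_op T -> compact_op (- T).
Proof.
rewrite /compact_op precompactE => cT.
apply: (@precompact_sub _ _ (-%R @` closure (T @` [set x | `|x| <= 1]))).
  by apply: continuous_compact => //; apply: continuous_subspaceT => ?; exact: opp_continuous.
by move=> _ [x x1 <-]; exists (T x) => //; apply: subset_closure; exists x.
Qed.

Lemma compact_opD (U V : hilbertType R) (S T : bop U V) :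
  compact_op S -> compact_op T -> compact_op (S + T).
Proof.
rewrite /compact_op precompactE => cS; rewrite precompactE => cT.
apply: (@precompact_sub V _ ((fun z : V * V => z.1 + z.2) @`
  (closure (S @` [set x | `|x| <= 1]) `*` closure (T @` [set x | `|x| <= 1])))).
  apply: continuous_compact; last exact: compact_setX.
  by apply: continuous_subspaceT => ?; exact: add_continuous.
by move=> _ [x x1 <-]; exists (S x, T x) => //; split => /=; apply: subset_closure; exists x.
Qed.

Lemma compact_op_compl (U V W : hilbertType R) (S : bop V W) (T : bop U V) :
  compact_op T -> compact_op (bop_comp S T).
Proof.
rewrite /compact_op precompactE => cT.
apply: (@precompact_sub _ _ (S @` closure (T @` [set x | `|x| <= 1]))).
  by apply: continuous_compact => //; apply: continuous_subspaceT; exact: bop_continuous.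
by move=> _ [x x1 <-]; exists (T x) => //; apply: subset_closure; exists x.
Qed.

Lemma compact_op_compr (U V W : hilbertType R) (S : bop V W) (T : bop U V) :
  compact_op S -> compact_op (bop_comp S T).
Proof.
have [M [M0 TM]] := bop_boundW T.
rewrite /compact_op precompactE => cS.
apply: (@precompact_sub _ _
  ((fun y : W => M *: y) @` closure (S @` [set x | `|x| <= 1]))).
  by apply: continuous_compact => //; apply: continuous_subspaceT; exact: scaler_continuous.
move=> _ [x x1 <-]; exists (S (M^-1 *: T x)); last first.
  by rewrite linearZ /= scalerA divff ?scale1r// gt_eqF.
apply: subset_closure; exists (M^-1 *: T x) => //=.
rewrite normrZ gtr0_norm ?invr_gt0// mulrC ler_pdivrMr// mul1r.
by apply: (le_trans (TM x)); rewrite -[leRHS]mulr1 ler_pM2l.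
Qed.

End BoundedOperators.

Section Calkin.
Variables (R : realType) (H : hilbertType R).
Local Open Scope quotient_scope.

Definition calkin_rel (S T : bop H H) : bool := `[< compact_op (S - T) >].

Lemma calkin_rel_equiv : equiv_class_of calkin_rel.
Proof.
split=> [S|S T|T S L].
- by apply/asboolP; rewrite subrr; exact: compact_op0.
- by apply/asboolP/asboolP => /compact_opN; rewrite opprB.
- move=> /asboolP ST /asboolP TL; apply/asboolP.
  by have := compact_opD ST TL; rewrite addrA subrK.
Qed.

Canonical calkin_equiv := EquivRelPack calkin_rel_equiv.

Definition calkin := {eq_quot calkin_rel}.
HB.instance Definition _ : EqQuotient (bop H H) calkin_rel calkin :=
  EqQuotient.on calkin.
HB.instance Definition _ := Choice.on calkin.

Lemma calkinP (S T : bop H H) :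
  reflect (compact_op (S - T)) (S == T %[mod calkin]).
Proof. by rewrite piE; exact: asboolP. Qed.

Definition calkin0 : calkin := lift_cst calkin 0.
Definition calkin1 : calkin := lift_cst calkin 1.
Definition calkin_opp := lift_op1 calkin -%R.
Definition calkin_add := lift_op2 calkin +%R.
Definition calkin_mul := lift_op2 calkin *%R.
Canonical pi_calkin0_morph := PiConst calkin0.
Canonical pi_calkin1_morph := PiConst calkin1.

Lemma pi_calkin_opp : {morph \pi : x / - x >-> calkin_opp x}.
Proof.
move=> S; unlock calkin_opp; apply/eqP/calkinP; rewrite -opprD.
by apply/compact_opN/calkinP; rewrite reprK.
Qed.
Canonical pi_calkin_opp_morph := PiMorph1 pi_calkin_opp.

Lemma pi_calkin_add : {morph \pi : x y / x + y >-> calkin_add x y}.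
Proof.
move=> S T; unlock calkin_add; apply/eqP/calkinP.
rewrite opprD addrACA.
by apply: compact_opD; apply/calkinP; rewrite reprK.
Qed.
Canonical pi_calkin_add_morph := PiMorph2 pi_calkin_add.

Lemma pi_calkin_mul : {morph \pi : x y / x * y >-> calkin_mul x y}.
Proof.
move=> S T; unlock calkin_mul; apply/eqP/calkinP.
set S' := repr _; set T' := repr _.
have -> : S * T - S' * T' = (S - S') * T + S' * (T - T').
  by rewrite mulrBl mulrBr addrA subrK.
apply: compact_opD; [apply: compact_op_compr|apply: compact_op_compl];
  by apply/calkinP; rewrite reprK.
Qed.
Canonical pi_calkin_mul_morph := PiMorph2 pi_calkin_mul.

Lemma calkin_addA : associative calkin_add.
Proof.
by move=> x y z; rewrite -[x]reprK -[y]reprK -[z]reprK !piE addrA.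
Qed.
Lemma calkin_addC : commutative calkin_add.
Proof. by move=> x y; rewrite -[x]reprK -[y]reprK !piE addrC. Qed.
Lemma calkin_add0 : left_id calkin0 calkin_add.
Proof. by move=> x; rewrite -[x]reprK !piE add0r. Qed.
Lemma calkin_addN : left_inverse calkin0 calkin_opp calkin_add.
Proof. by move=> x; rewrite -[x]reprK !piE addNr. Qed.
HB.instance Definition _ := GRing.isZmodule.Build calkin
  calkin_addA calkin_addC calkin_add0 calkin_addN.

Lemma calkin_mulA : associative calkin_mul.
Proof.
by move=> x y z; rewrite -[x]reprK -[y]reprK -[z]reprK !piE mulrA.
Qed.
Lemma calkin_mul1 : left_id calkin1 calkin_mul.
Proof. by move=> x; rewrite -[x]reprK !piE mul1r. Qed.
Lemma calkin_mulr1 : right_id calkin1 calkin_mul.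
Proof. by move=> x; rewrite -[x]reprK !piE mulr1. Qed.
Lemma calkin_mulDl : left_distributive calkin_mul calkin_add.
Proof.
by move=> x y z; rewrite -[x]reprK -[y]reprK -[z]reprK !piE mulrDl.
Qed.
Lemma calkin_mulDr : right_distributive calkin_mul calkin_add.
Proof.
by move=> x y z; rewrite -[x]reprK -[y]reprK -[z]reprK !piE mulrDr.
Qed.
HB.instance Definition _ := GRing.Zmodule_isPzRing.Build calkin
  calkin_mulA calkin_mul1 calkin_mulr1 calkin_mulDl calkin_mulDr.

Definition calkin_class (T : bop H H) : calkin := \pi T.

(* Independent of the representative, since adjoints of compact operators are
   compact. *)
Definition calkin_star (a : calkin) : calkin := calkin_class (adjoint (repr a)).

Definition calkin_norm (a : calkin) : R :=
  inf [set opnorm T | T in [set T : bop H H | calkin_class T = a]].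

End Calkin.

(* These notions only involve the ring operations, the involution and the norm
   of a C*-algebra, which are passed explicitly. *)
Definition defects (A : pzRingType) (star : A -> A) (a b : A) : seq A :=
  [:: 1 - star a * a; 1 - a * star a; 1 - star b * b; 1 - b * star b].

Definition balanced (R : realType) (A : pzRingType) (star : A -> A)
    (nrm : A -> R) (a b : A) : Prop :=
  [/\ nrm a <= 1, nrm b <= 1 &
    forall c, c \in defects star a b ->
      (a - b) * c = 0 /\ (star a - star b) * c = 0].

Definition K_balanced (R : realType) (H : hilbertType R) (A B : bop H H) :=
  balanced (@calkin_star R H) (@calkin_norm R H)
    (calkin_class A) (calkin_class B).

Section Subspaces.
Variables (R : realType) (H : hilbertType R).

Record closedSubspace := ClosedSubspace {
  subspace_pred :> {pred H} ;
  subspace_submod : submod_closed subspace_pred ;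
  subspace_closed : closed [set x | x \in subspace_pred]
}.

Variable S : closedSubspace.
HB.instance Definition _ :=
  GRing.isSubmodClosed.Build R[i] H (subspace_pred S) (subspace_submod S).

Record subspace_type := SubspaceElt {
  subspace_val : H ;
  subspace_valP : subspace_val \in subspace_pred S
}.
HB.instance Definition _ := [isSub of subspace_type for subspace_val].
HB.instance Definition _ := [Choice of subspace_type by <:].
HB.instance Definition _ := [SubChoice_isSubLmodule of subspace_type by <:].


Definition subspace_norm (x : subspace_type) : R[i] := `|val x|.
Lemma subspace_normD x y :
  subspace_norm (x + y) <= subspace_norm x + subspace_norm y.
Proof. exact: ler_normD. Qed.
Lemma subspace_normZ (a : R[i]) x : subspace_norm (a *: x) = `|a| * subspace_norm x.
Proof. exact: normrZ. Qed.
Lemma subspace_norm0 x : subspace_norm x = 0 -> x = 0.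
Proof. by move=> /normr0_eq0 x0; apply: val_inj; rewrite x0. Qed.
HB.instance Definition _ := @Lmodule_isNormed.Build R[i] subspace_type
  subspace_norm subspace_normD subspace_normZ subspace_norm0.

Lemma subspace_normE (x : subspace_type) : `|x| = `|val x|.
Proof. by []. Qed.

Lemma subspace_complete (F : set_system subspace_type) :
  ProperFilter F -> cauchy F -> cvg F.
Proof.
move=> FF /cauchyP Fc.
have Gc : cauchy (val @ F).
  apply/cauchyP => e e0; have [x Fx] := Fc e e0; exists (val x).
  by move: Fx; rewrite /= -!ball_normE.
have /cauchy_cvg/cvg_ex[l Gl] := Gc.
have lS : l \in subspace_pred S.
  apply: (@subspace_closed S) => B /Gl /(@filter_ex _ F FF)[x Bx].
  by exists (val x); split => //; exact: subspace_valP.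
apply/cvg_ex; exists (SubspaceElt lS); apply/cvgrPdist_lt => e e0.
by move/cvgrPdist_lt : Gl => /(_ e e0).
Qed.
HB.instance Definition _ := Uniform_isComplete.Build subspace_type subspace_complete.

Definition subspace_inner (x y : subspace_type) : R[i] := inner (val x) (val y).
Lemma subspace_innerPl (a : R[i]) (x y z : subspace_type) :
  subspace_inner (a *: x + y) z = a * subspace_inner x z + subspace_inner y z.
Proof. by rewrite /subspace_inner linearP innerPl. Qed.
Lemma subspace_inner_conj x y : subspace_inner y x = Num.conj (subspace_inner x y).
Proof. exact: inner_conj. Qed.
Lemma subspace_inner_norm x : subspace_inner x x = `|x| ^+ 2.
Proof. exact: inner_norm. Qed.
HB.instance Definition _ := CompleteNormedModule_isHilbert.Build R subspace_type
  subspace_innerPl subspace_inner_conj subspace_inner_norm.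

Lemma incl_linear : linear (val : subspace_type -> H).
Proof. by move=> a x y; rewrite linearP. Qed.
Lemma incl_bounded : exists M : R[i], forall x : subspace_type, `|val x| <= M * `|x|.
Proof. by exists 1 => x; rewrite mul1r. Qed.
Definition incl : bop subspace_type H := Bop incl_linear incl_bounded.

End Subspaces.

Section Decomposition.
Variables (R : realType) (H : hilbertType R).

(* The summands H_1 and H_2 are indexed by 0 and 1 in 'I_2. *)
Record orthodecomp := OrthoDecomp {
  summand : 'I_2 -> closedSubspace H ;
  summand_ortho : forall i j, i != j -> forall x y,
    x \in summand i -> y \in summand j -> inner x y = 0 ;
  summand_span : forall x, exists y : forall i, subspace_type (summand i),
    x = \sum_i val (y i)
}.

Variable D : orthodecomp.
Local Notation H_ i := (subspace_type (summand D i)).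

Definition component (i : 'I_2) (x : H) : H_ i :=
  projT1 (cid (summand_span D x)) i.

Lemma componentE x : x = \sum_i val (component i x).
Proof. by rewrite /component; case: cid. Qed.

Lemma inner0l (z : H) : inner 0 z = 0.
Proof.
have := innerPl (-1) 0 0 z; rewrite scaler0 addr0 mulN1r => ->; exact: addNr.
Qed.

Lemma innerDl (x y z : H) : inner (x + y) z = inner x z + inner y z.
Proof. by have := innerPl 1 x y z; rewrite scale1r mul1r. Qed.

Lemma inner_suml (I : finType) (f : I -> H) z :
  inner (\sum_i f i) z = \sum_i inner (f i) z.
Proof. exact: (big_morph (inner^~ z) (fun x y => innerDl x y z) (inner0l z)). Qed.

Lemma inner_summand (i : 'I_2) (y : forall j, H_ j) (z : H_ i) :
  inner (\sum_j val (y j)) (val z) = inner (y i) z.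
Proof.
rewrite inner_suml (bigD1 i)//= big1 ?addr0// => j ji.
by apply: (summand_ortho ji); exact: valP.
Qed.

Lemma inner_component i x (z : H_ i) : inner x (val z) = inner (component i x) z.
Proof. by have := inner_summand (component^~ x) z; rewrite -componentE. Qed.

Lemma component_unique i (y : forall j, H_ j) x :
  x = \sum_j val (y j) -> component i x = y i.
Proof.
move=> xy; apply/subr0_eq/normr0_eq0/eqP; rewrite -sqrf_eq0 -inner_norm.
have [z zE] : exists z, z = component i x - y i by eexists.
rewrite -zE {1}zE.
have := innerPl (-1) (y i) (component i x) z; rewrite scaleN1r addrC => ->.
by rewrite -inner_component mulN1r -(inner_summand y) -xy addNr.
Qed.

Lemma component_linear i : linear (component i).
Proof.
move=> a x y.
rewrite (@component_unique i (fun j => a *: component j x + component j y))//.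
rewrite {1}[x]componentE {1}[y]componentE scaler_sumr -big_split /=.
exact: eq_bigr.
Qed.

Lemma component_bounded i : exists M : R[i], forall x, `|component i x| <= M * `|x|.
Proof.
exists 1 => x; rewrite mul1r -ler_sqr ?nnegrE//.
have e : `|x| ^+ 2 = \sum_j `|component j x| ^+ 2.
  rewrite -inner_norm; have := inner_suml (fun j => val (component j x)) x.
  rewrite -componentE => ->; apply: eq_bigr => j _.
  by rewrite inner_conj inner_component -inner_conj inner_norm.
by rewrite e (bigD1 i)//= lerDl sumr_ge0// => j _; rewrite exprn_ge0.
Qed.

Definition proj i : bop H (H_ i) := Bop (component_linear i) (component_bounded i).

Definition entry (T : bop H H) (i j : 'I_2) : bop (H_ j) (H_ i) :=
  bop_comp (proj i) (bop_comp T (incl (summand D j))).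

End Decomposition.

(* Main.v *)
Require Import Defs.
From mathcomp Require Import all_boot all_order all_algebra.
From mathcomp Require Import all_classical all_reals all_analysis.
From mathcomp Require Import complex.
From mathcomp Require Import ring lra.
Set Implicit Arguments.
Unset Strict Implicit.
Unset Printing Implicit Defensive.
Import Order.TTheory GRing.Theory Num.Theory.
Import numFieldNormedType.Exports.
Local Open Scope classical_set_scope.
Local Open Scope ring_scope.
Local Open Scope complex_scope.

(** Put [S = A - B] and [T = S^* S + S S^*], a positive operator with
    [<T x, x> = |S x|^2 + |S^* x|^2].  Let [H_2] be the spectral subspace of [T]
    for the interval from [0] to [(eps/2)^2], and [H_1] its orthogonal
    complement.

    On [H_2] the quadratic form of [T] is at most [(eps/2)^2], so both [S] and
    [S^*] have norm at most [eps/2] there.  An entry of [S] that starts in [H_2]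
    is controlled by [S], and the one from [H_1] to [H_2] is controlled by [S^*]
    through duality ([opnorm_entry]).

    On [H_1] the operator [T] is bounded below.  For a defect [C] the balance
    condition makes [S C] and [S^* C] compact, hence also
    [T C = S^* (S C) + S (S^* C)].  Dividing by [T] on its invariant subspace
    [H_1] shows that [P_1 C] is compact ([compact_component_ortho]).  As [C] is
    self-adjoint, [C P_1] is the adjoint of [P_1 C] and is compact by Schauder's
    theorem.  So every entry of [C] other than the one from [H_2] to [H_2] is
    compact, and the small summand can be taken to be [0].

    The balance condition is stated in the Calkin algebra, where the involution
    is computed on representatives; Schauder's theorem is what allows it to be
    read off the operators [A] and [B] ([K_balanced_compact]).

    The spectral subspace ([spectral_splitting]) is obtained from an absolute
    value and not from the spectral theorem.  If [X] is a positive multiple of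
    [T - delta] and [L = |X|] commutes with [X], then [(L - X) (L + X) = 0];
    therefore [X = - L <= 0] on the kernel of [L + X] and [X = L >= 0] on its
    orthogonal complement.  The absolute value, the square root of [X X], is
    [1 - Y] where [Y] is the norm limit of the iteration [Y -> (Z + Y Y) / 2]
    with [Z = 1 - X X] ([sqrt_limit]).

    Estimates are made with the real norm [rnorm] and the real part [rinner] of
    the inner product: the real inner product determines the complex one
    ([inner_eqP]), and it turns all inequalities into inequalities between real
    numbers. *)

(** * The underlying real inner product *)
Section RealParts.
Variables (R : realType) (H : hilbertType R).
Implicit Types (x y z : H) (a : R[i]) (r : R).

Definition rnorm x : R := complex.Re `|x|.
Definition rinner x y : R := complex.Re (inner x y).

Lemma rnormE x : `|x| = (rnorm x)%:C.
Proof. by rewrite /rnorm RRe_real// normr_real. Qed.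

Lemma rnorm_ge0 x : 0 <= rnorm x.
Proof. by rewrite -ler0c -rnormE. Qed.

Lemma rnorm0 : rnorm 0 = 0.
Proof. by rewrite /rnorm normr0. Qed.

Lemma rnormD x y : rnorm (x + y) <= rnorm x + rnorm y.
Proof. by rewrite -lecR rmorphD /= -!rnormE ler_normD. Qed.

Lemma rnormN x : rnorm (- x) = rnorm x.
Proof. by rewrite /rnorm normrN. Qed.

Lemma rnormB x y : rnorm (x - y) = rnorm (y - x).
Proof. by rewrite -rnormN opprB. Qed.

Lemma rnormZ r x : rnorm (r%:C *: x) = `|r| * rnorm x.
Proof.
apply: complexI; rewrite -rnormE normrZ rnormE rmorphM /=; congr (_ * _).
by rewrite normc_def /= expr0n addr0 sqrtr_sqr.
Qed.

Lemma rnorm_eq0 x : rnorm x = 0 -> x = 0.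
Proof. by move=> x0; apply: normr0_eq0; rewrite rnormE x0. Qed.

Lemma innerZl a x y : inner (a *: x) y = a * inner x y.
Proof. by rewrite -[a *: x]addr0 innerPl inner0l addr0. Qed.

Lemma rinnerDl x y z : rinner (x + y) z = rinner x z + rinner y z.
Proof. by rewrite /rinner innerDl; case: (inner x z) (inner y z) => [? ?] []. Qed.

Lemma rinnerZl r x y : rinner (r%:C *: x) y = r * rinner x y.
Proof. by rewrite /rinner innerZl; case: (inner x y) => ? ? /=; rewrite mul0r subr0. Qed.

Lemma rinnerC x y : rinner x y = rinner y x.
Proof. by rewrite /rinner inner_conj; case: (inner y x) => ? ?. Qed.

Lemma rinner0l y : rinner 0 y = 0.
Proof. by rewrite /rinner inner0l. Qed.

Lemma rinnerNl x y : rinner (- x) y = - rinner x y.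
Proof. by apply/eqP; rewrite -addr_eq0 -rinnerDl addNr rinner0l. Qed.

Lemma rinnerBl x y z : rinner (x - y) z = rinner x z - rinner y z.
Proof. by rewrite rinnerDl rinnerNl. Qed.

Lemma rinnerDr x y z : rinner z (x + y) = rinner z x + rinner z y.
Proof. by rewrite !(rinnerC z) rinnerDl. Qed.

Lemma rinnerNr x y : rinner x (- y) = - rinner x y.
Proof. by rewrite !(rinnerC x) rinnerNl. Qed.

Lemma rinnerBr x y z : rinner z (x - y) = rinner z x - rinner z y.
Proof. by rewrite rinnerDr rinnerNr. Qed.

Lemma rinnerZr r x y : rinner x (r%:C *: y) = r * rinner x y.
Proof. by rewrite !(rinnerC x) rinnerZl. Qed.

Lemma rinner_norm x : rinner x x = rnorm x ^+ 2.
Proof. by rewrite /rinner inner_norm rnormE -rmorphXn. Qed.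

(** Taking [a = 1] and [a = - i] recovers the real and imaginary parts. *)
Lemma Re_mul_inj (u v : R[i]) :
  (forall a, complex.Re (a * u) = complex.Re (a * v)) -> u = v.
Proof.
move=> uv; have := uv 1; have := uv (0 -i* 1); case: u v {uv} => [u1 u2] [v1 v2] /=.
by rewrite !mul0r !mul1r !mulN1r !opprK !subr0 !add0r => -> ->.
Qed.

Lemma rinner_cs x y : rinner x y <= rnorm x * rnorm y.
Proof.
have [x0|x0] := eqVneq (rnorm x) 0.
  by rewrite (rnorm_eq0 x0) rinner0l rnorm0 mul0r.
have [y0|y0] := eqVneq (rnorm y) 0.
  by rewrite (rnorm_eq0 y0) rinnerC rinner0l rnorm0 mulr0.
have xy : 0 < rnorm x * rnorm y by rewrite mulr_gt0// lt_def rnorm_ge0 andbT.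
have := sqr_ge0 (rnorm ((rnorm y)%:C *: x - (rnorm x)%:C *: y)).
rewrite -rinner_norm rinnerBl !rinnerBr !rinnerZl !rinnerZr !rinner_norm (rinnerC y x).
move: (rinner x y) (rnorm x) (rnorm y) xy => p a b ab.
by move=> h; rewrite -subr_ge0 -(pmulr_rge0 _ ab); lra.
Qed.

Lemma rnorm_Cauchy_Schwarz x y : `|rinner x y| <= rnorm x * rnorm y.
Proof. by rewrite ler_norml rinner_cs lerNl -rinnerNl -(rnormN x) rinner_cs. Qed.

Lemma rnorm_sqrD x y :
  rnorm (x + y) ^+ 2 = rnorm x ^+ 2 + 2 * rinner x y + rnorm y ^+ 2.
Proof. by rewrite -!rinner_norm rinnerDl !rinnerDr (rinnerC y x); ring. Qed.

Lemma cvg_rnormP (u : nat -> H) (l : H) :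
  (u n @[n --> \oo] --> l) <->
  forall e : R, 0 < e -> exists N, forall n, (N <= n)%N -> rnorm (u n - l) < e.
Proof.
split=> [/cvgrPdist_lt ul e e0|ul].
  have [|N _ Nu] := ul e%:C; first by rewrite ltcR.
  by exists N => n /Nu /=; rewrite rnormE ltcR rnormB.
apply/cvgrPdist_lt => e e0; have [] := ul (complex.Re e).
  by move: e0; rewrite ltcE => /andP[].
move=> N Nu; exists N => // n /Nu une /=.
by rewrite rnormE rnormB -[e]RRe_real ?ltcR ?gtr0_real.
Qed.

Lemma cauchy_rnorm_cvg (u : nat -> H) :
  (forall e : R, 0 < e -> exists N, forall n, (N <= n)%N -> rnorm (u n - u N) < e) ->
  exists l : H, u n @[n --> \oo] --> l.
Proof.
move=> uC; apply/cvg_ex; apply: cauchy_cvg. apply/cauchyP => e e0.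
have [|N Nu] := uC (complex.Re e); first by move: e0; rewrite ltcE => /andP[].
exists (u N), N => // n /= /Nu une; rewrite -ball_normE /=.
by rewrite rnormE rnormB -[e]RRe_real ?ltcR ?gtr0_real.
Qed.

(** The two kinds of subspaces used below, kernels and orthogonal complements,
    are shown to be closed by approximation of a limit point. *)
Lemma closed_rnorm (S : set H) :
  (forall x, (forall e : R, 0 < e -> exists2 y, S y & rnorm (x - y) < e) -> S x) ->
  closed S.
Proof.
move=> SP x Sx; apply: SP => e e0.
have [|y [Sy]] := Sx (ball x e%:C); first by apply: nbhsx_ballx; rewrite ltcR.
by rewrite -ball_normE /= rnormE ltcR => xy; exists y.
Qed.

End RealParts.

(** Complex multiples of the left argument exhibit the imaginary part of the
    inner product as a real part. *)
Lemma inner_eqP (R : realType) (G H : hilbertType R) (x y : H) (u v : G) :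
  (forall a, rinner (a *: x) y = rinner (a *: u) v) -> inner x y = inner u v.
Proof. by move=> e; apply: Re_mul_inj => a; rewrite -!innerZl; exact: e. Qed.

Section Bounds.
Variables (R : realType) (U V : hilbertType R).

Lemma bop_rnorm (T : bop U V) :
  exists2 m : R, 0 < m & forall x, rnorm (T x) <= m * rnorm x.
Proof.
have [M [M0 TM]] := bop_boundW T; have Mr := RRe_real (gtr0_real M0).
exists (complex.Re M); first by rewrite -ltcR Mr.
by move=> x; rewrite -lecR rmorphM /= Mr -!rnormE.
Qed.

Lemma rnorm_bounded (f : U -> V) (m : R) :
  (forall x, rnorm (f x) <= m * rnorm x) ->
  exists M : R[i], forall x, `|f x| <= M * `|x|.
Proof. by move=> fm; exists m%:C => x; rewrite !rnormE -rmorphM lecR. Qed.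

Lemma opnorm_le (T : bop U V) (m : R) : 0 <= m ->
  (forall x, rnorm (T x) <= m * rnorm x) -> opnorm T <= m.
Proof.
move=> m0 Tm; apply: ge_sup.
  by exists (rnorm (T 0)); exists 0 => //=; rewrite normr0.
move=> _ [x /= x1 <-]; apply: (le_trans (Tm x)).
by rewrite -[leRHS]mulr1 ler_wpM2l// -lecR -rnormE.
Qed.

End Bounds.

(** * The Riesz representation theorem *)
Section Riesz.
Variables (R : realType) (H : hilbertType R).

(** The representing vector minimises [J x = |x|^2 - 2 g x], which is bounded
    below because [g] is bounded.  By the parallelogram law a minimising sequence
    is Cauchy, and the first variations [<h, u n> - g h] along it tend to [0], so
    that its limit [z] satisfies [g h = <h, z>]. *)
Lemma riesz_real (g : H -> R) (m : R) :
  (forall x y, g (x + y) = g x + g y) ->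
  (forall r x, g (r%:C *: x) = r * g x) ->
  (forall x, `|g x| <= m * rnorm x) ->
  exists z, forall x, g x = rinner x z.
Proof.
move=> gD gZ gm; pose J x := rnorm x ^+ 2 - 2 * g x.
pose S := [set J x | x in [set: H]].
have JD x h : J (x + h) = J x + 2 * (rinner x h - g h) + rnorm h ^+ 2.
  by rewrite /J rnorm_sqrD gD; ring.
have Sinf : has_inf S.
  split; first by exists (J 0), 0.
  exists (- m ^+ 2) => _ [x _ <-]; rewrite /J.
  have := gm x; rewrite ler_norml => /andP[_ gx].
  by have := sqr_ge0 (rnorm x - m); nra.
have Jinf x : inf S <= J x by apply: ge_inf; [exact: Sinf.2|exists x].
(* Parallelogram law: [x] and [y] have a midpoint at which [J >= inf S]. *)
have near_min x y e : J x <= inf S + e -> J y <= inf S + e ->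
    rnorm (x - y) ^+ 2 <= 4 * e.
  move=> Jx Jy; have := Jinf ((2^-1)%:C *: (x + y)).
  rewrite {1}/J rnormZ gZ gD exprMn real_normK ?num_real// !rnorm_sqrD.
  by move: Jx Jy; rewrite /J rinnerNr rnormN; lra.
have /choice[u uJ] : forall n, exists x, J x < inf S + n.+1%:R^-1.
  move=> n; have [|_ [x _ <-] xn] := @inf_adherent _ S n.+1%:R^-1 _ Sinf.
    by rewrite invr_gt0.
  by exists x.
have [|z uz] := @cauchy_rnorm_cvg _ _ u.
  move=> e e0; have e50 : 0 < e ^+ 2 / 5 by rewrite divr_gt0// exprn_gt0.
  have [N _ NP] := near_infty_natSinv_lt (PosNum e50); exists N => n Nn.
  have uN k : (N <= k)%N -> J (u k) <= inf S + e ^+ 2 / 5.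
    by move=> Nk; apply: ltW (lt_trans (uJ k) _); rewrite ltrD2l; exact: NP.
  have h := near_min _ _ _ (uN _ Nn) (uN _ (leqnn N)).
  rewrite -ltr_sqr ?nnegrE ?rnorm_ge0 ?ltW//; apply: (le_lt_trans h).
  by have := exprn_gt0 2 e0; lra.
(* A quadratic polynomial in [t] that stays above [- n.+1%:R^-1] has a bounded
   linear coefficient; [t] is the minimiser of that polynomial. *)
have variation n h : (rinner (u n) h - g h) ^+ 2 <= n.+1%:R^-1 * rnorm h ^+ 2.
  have [h0|h0] := eqVneq (rnorm h) 0.
    rewrite (rnorm_eq0 h0) rnorm0 rinnerC rinner0l -(scale0r (0 : H)).
    by rewrite (gZ 0) mul0r subrr !expr0n mulr0.
  have h2 : 0 < rnorm h ^+ 2 by rewrite exprn_gt0// lt_def h0 rnorm_ge0.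
  set c := rinner _ _ - _; pose t := - (c / rnorm h ^+ 2).
  have := Jinf (u n + t%:C *: h); rewrite JD rinnerZr gZ -mulrBr -/c rnormZ.
  rewrite exprMn real_normK ?num_real// => Jt.
  rewrite -ler_pdivrMr//.
  have -> : c ^+ 2 / rnorm h ^+ 2 = - (2 * (t * c) + t ^+ 2 * rnorm h ^+ 2).
    by rewrite /t; field.
  move: (uJ n) Jt; move: (inf S) (J (u n)) (n.+1%:R^-1) (t * c) (t ^+ 2 * _).
  by move=> *; lra.
exists z => h; apply/eqP; rewrite -subr_eq0 -sqrf_eq0; apply/eqP/le_anti.
rewrite sqr_ge0 andbT; apply/ler_addgt0Pl => e e0; rewrite addr0.
have k0 : 0 < 1 + 4 * rnorm h ^+ 2 by have := sqr_ge0 (rnorm h); lra.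
(* [k <= 1] gives [k ^+ 2 <= k], so one bound serves the distance and its square. *)
pose k := Num.min 1 (e / (1 + 4 * rnorm h ^+ 2)).
have kp : 0 < k by rewrite lt_min ltr01 divr_gt0.
have ke : 4 * rnorm h ^+ 2 * k <= e.
  have : k <= e / (1 + 4 * rnorm h ^+ 2) by rewrite ge_min lexx orbT.
  by rewrite ler_pdivlMr//; lra.
have [N _ NP] := near_infty_natSinv_lt (PosNum kp).
have [N' N'P] := (cvg_rnormP _ _).1 uz _ kp.
have {NP} /ltW /= n1 := NP _ (leq_maxl N N').
have {N'P} /ltW n2 := N'P _ (leq_maxr N N').
move: (maxn N N') n1 n2 => n n1 n2.
have {}n2 : rnorm (u n - z) ^+ 2 <= k.
  apply: le_trans (_ : k ^+ 2 <= _).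
    by rewrite ler_sqr ?nnegrE ?rnorm_ge0 ?(ltW kp).
  by rewrite expr2 ler_piMl ?(ltW kp)// ge_min lexx.
have cs : rinner (u n - z) h ^+ 2 <= rnorm (u n - z) ^+ 2 * rnorm h ^+ 2.
  rewrite -exprMn -[leLHS]real_normK ?num_real// ler_sqr ?nnegrE ?mulr_ge0 ?rnorm_ge0//.
  exact: rnorm_Cauchy_Schwarz.
have h2 := sqr_ge0 (rnorm h).
have {}cs := le_trans cs (ler_wpM2r h2 n2).
have {}n1 := le_trans (variation n h) (ler_wpM2r h2 n1).
apply: le_trans ke; have := sqr_ge0 ((rinner (u n) h - g h) + rinner (u n - z) h).
rewrite (rinnerC h); move: cs n1; rewrite rinnerBl.
move: (rinner (u n) h) (g h) (rinner z h) (rnorm h ^+ 2) (k) => a b c d f.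
by move=> *; lra.
Qed.
End Riesz.

(** * Adjoints *)
Section Adjoint.
Variables (R : realType) (H : hilbertType R).
Implicit Types S T : bop H H.

(** Apply the Riesz theorem to [x |-> <T x, y>] for each [y]; linearity of the
    resulting map follows because inner products separate vectors. *)
Lemma adjoint_exists T : exists S, forall x y, inner (T x) y = inner x (S y).
Proof.
have [m m0 Tm] := bop_rnorm T.
have /choice[f fE] : forall y, exists z, forall x, rinner (T x) y = rinner x z.
  move=> y; apply: (@riesz_real _ _ (fun x => rinner (T x) y) (m * rnorm y)).
  - by move=> x z; rewrite linearD rinnerDl.
  - by move=> r x; rewrite linearZ rinnerZl.
  - move=> x; apply: (le_trans (rnorm_Cauchy_Schwarz _ _)).
    by rewrite mulrAC ler_wpM2r ?rnorm_ge0.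
have fI x y : inner (T x) y = inner x (f y).
  by apply: inner_eqP => a; rewrite -linearZ fE.
have flin : linear f.
  move=> a y z; apply/eqP; rewrite -subr_eq0; apply/eqP/rnorm_eq0/eqP.
  rewrite -sqrf_eq0 -rinner_norm; set w := f _ - _; rewrite {2}/w.
  have E x : inner x (f (a *: y + z)) = inner x (a *: f y + f z).
    rewrite -fI ![inner _ (_ + _)]inner_conj !innerPl.
    by rewrite !(inner_conj (T x)) !fI -!inner_conj.
  by rewrite rinnerBr /rinner E subrr.
have fm y : rnorm (f y) <= m * rnorm y.
  have [->|f0] := eqVneq (rnorm (f y)) 0; first by rewrite mulr_ge0 ?rnorm_ge0 ?ltW.
  have fp : 0 < rnorm (f y) by rewrite lt_def f0 rnorm_ge0.
  rewrite -(ler_pM2l fp) -expr2 -rinner_norm -fE.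
  apply: le_trans (rinner_cs _ _) _; rewrite mulrCA mulrA.
  by rewrite ler_wpM2r ?rnorm_ge0.
by exists (Bop flin (rnorm_bounded fm)).
Qed.

Lemma inner_adjoint T x y : inner (T x) y = inner x (adjoint T y).
Proof.
by have [S TS] := adjoint_exists T; rewrite /adjoint; case: xgetP => [L -> //|/(_ S)].
Qed.

Lemma rinner_adjoint T x y : rinner (T x) y = rinner x (adjoint T y).
Proof. by rewrite /rinner inner_adjoint. Qed.

Lemma adjoint_unique S T :
  (forall x y, rinner (T x) y = rinner x (S y)) -> adjoint T = S.
Proof.
move=> TS; apply: bopP => y; apply/subr0_eq/rnorm_eq0/eqP.
by rewrite -sqrf_eq0 -rinner_norm rinnerBr -TS -rinner_adjoint subrr.
Qed.

Lemma adjointK T : adjoint (adjoint T) = T.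
Proof. by apply: adjoint_unique => x y; rewrite rinnerC -rinner_adjoint rinnerC. Qed.

Lemma adjointD S T : adjoint (S + T) = adjoint S + adjoint T.
Proof.
by apply: adjoint_unique => x y; rewrite rinnerDr -!rinner_adjoint -rinnerDl.
Qed.

Lemma adjointN T : adjoint (- T) = - adjoint T.
Proof. by apply: adjoint_unique => x y; rewrite rinnerNr -rinner_adjoint -rinnerNl. Qed.

Lemma adjointB S T : adjoint (S - T) = adjoint S - adjoint T.
Proof. by rewrite adjointD adjointN. Qed.

Lemma adjointM S T : adjoint (S * T) = adjoint T * adjoint S.
Proof. by apply: adjoint_unique => x y; rewrite -!rinner_adjoint. Qed.

Lemma adjoint1 : adjoint (1 : bop H H) = 1.
Proof. exact: adjoint_unique. Qed.

(** [bop H H] carries no scalar multiplication; real multiples of the identity,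
    as elements of the ring, replace it. *)
Definition scal_bop (r : R) : bop H H.
Proof.
apply: (@Bop _ H H (fun x => r%:C *: x)).
  by move=> a x y; rewrite scalerDr !scalerA mulrC.
by apply: (@rnorm_bounded _ _ _ _ `|r|) => x; rewrite rnormZ.
Defined.

Lemma adjoint_scal r : adjoint (scal_bop r) = scal_bop r.
Proof. by apply: adjoint_unique => x y; rewrite rinnerZl rinnerZr. Qed.

Lemma scal_bopC r T : scal_bop r * T = T * scal_bop r.
Proof. by apply: bopP => x /=; rewrite linearZ. Qed.

End Adjoint.

(** * Orthogonal decompositions *)
Section Ortho.
Variables (R : realType) (H : hilbertType R).
Variable M : closedSubspace H.

Lemma subspace0 : 0 \in subspace_pred M.
Proof. by case: (subspace_submod M). Qed.

Lemma subspace_linear (a : R[i]) x y : x \in subspace_pred M ->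
  y \in subspace_pred M -> a *: x + y \in subspace_pred M.
Proof. exact: (subspace_submod M).2. Qed.

Definition ortho_pred : {pred H} :=
  [pred x | `[< forall y, y \in subspace_pred M -> inner x y = 0 >]].

Lemma ortho_submod : submod_closed ortho_pred.
Proof.
split=> [|a x y /asboolP xM /asboolP yM]; apply/asboolP => z zM.
  by rewrite inner0l.
by rewrite innerPl xM// yM// mulr0 addr0.
Qed.

Lemma orthoP x :
  reflect (forall y, y \in subspace_pred M -> rinner x y = 0) (x \in ortho_pred).
Proof.
apply: (iffP (asboolP _)) => [xM y yM|xM y yM]; first by rewrite /rinner xM.
rewrite inner_conj -(inner0l x) [RHS](_ : _ = Num.conj (inner 0 x)); last first.
  by rewrite inner0l conjC0.
congr Num.conj; apply: inner_eqP => a.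
rewrite scaler0 rinner0l rinnerC xM// -[_ *: y]addr0.
by rewrite subspace_linear ?subspace0.
Qed.

Lemma ortho_closed : closed [set x | x \in ortho_pred].
Proof.
apply: closed_rnorm => x xM; apply/orthoP => y yM; apply/eqP.
rewrite -normr_eq0; apply/eqP/le_anti; rewrite normr_ge0 andbT.
apply/ler_addgt0Pl => e e0; rewrite addr0.
have k0 : 0 < 1 + rnorm y by have := rnorm_ge0 y; lra.
have [|z /orthoP zM xz] := xM (e / (1 + rnorm y)); first by rewrite divr_gt0.
rewrite -(subr0 (rinner x y)) -(zM y yM) -rinnerBl.
apply: le_trans (rnorm_Cauchy_Schwarz _ _) _.
apply: le_trans (ler_wpM2r (rnorm_ge0 y) (ltW xz)) _.
rewrite mulrAC ler_pdivrMr//; have := rnorm_ge0 y; nra.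
Qed.

Definition ortho := ClosedSubspace ortho_submod ortho_closed.

Lemma ortho_self x : x \in subspace_pred M -> x \in ortho_pred -> x = 0.
Proof.
move=> xM /orthoP/(_ x xM); rewrite rinner_norm => /eqP.
by rewrite sqrf_eq0 => /eqP /rnorm_eq0.
Qed.

(** The projection of [x] on [M] represents the functional [y |-> <y, x>] on
    the Hilbert space [M]. *)
Lemma ortho_split x :
  exists y z, [/\ y \in subspace_pred M, z \in ortho_pred & x = z + y].
Proof.
have [| | |y yE] := @riesz_real _ (subspace_type M) (fun y => rinner (val y) x) (rnorm x).
- by move=> y z; rewrite linearD rinnerDl.
- by move=> r y; rewrite linearZ rinnerZl.
- by move=> y; rewrite mulrC; exact: rnorm_Cauchy_Schwarz.
exists (val y), (x - val y); split; [exact: valP| |by rewrite subrK].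
apply/orthoP => w wM; have := yE (SubspaceElt wM) => /= e.
by rewrite rinnerBl rinnerC e rinnerC subrr.
Qed.

Definition ortho_summand (i : 'I_2) := if i == ord0 then ortho else M.

Lemma ortho_summand_ortho i j : i != j -> forall x y,
  x \in subspace_pred (ortho_summand i) ->
  y \in subspace_pred (ortho_summand j) -> inner x y = 0.
Proof.
rewrite /ortho_summand => ij x y.
have [i0|i0] := eqVneq i ord0; have [j0|j0] := eqVneq j ord0.
- by rewrite i0 j0 eqxx in ij.
- by move=> /asboolP xM yM; exact: xM.
- by move=> xM /asboolP yM; rewrite inner_conj yM// conjC0.
- by case: i j i0 j0 ij => [[|[|//]] ?] [[|[|//]] ?].
Qed.

Lemma ortho_summand_span x :
  exists y : forall i, subspace_type (ortho_summand i), x = \sum_i val (y i).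
Proof.
have [y [z [yM zM ->]]] := ortho_split x.
have wP i : (if i == ord0 then z else y) \in subspace_pred (ortho_summand i).
  by rewrite /ortho_summand; case: ifP.
by exists (fun i => SubspaceElt (wP i)); rewrite big_ord_recl big_ord1.
Qed.

Definition ortho_decomp := OrthoDecomp ortho_summand_ortho ortho_summand_span.

End Ortho.

Section Kernel.
Variables (R : realType) (H : hilbertType R) (T : bop H H).

Definition ker_pred : {pred H} := [pred x | T x == 0].

Lemma ker_submod : submod_closed ker_pred.
Proof.
split=> [|a x y /eqP Tx /eqP Ty]; rewrite !inE ?linear0//.
by rewrite (bop_linear T) Tx Ty scaler0 addr0.
Qed.

Lemma ker_closed : closed [set x | x \in ker_pred].
Proof.
have [m m0 Tm] := bop_rnorm T; apply: closed_rnorm => x xM; apply/eqP/rnorm_eq0/le_anti.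
rewrite rnorm_ge0 andbT; apply/ler_addgt0Pl => e e0; rewrite addr0.
have [|z /eqP zM xz] := xM (e / m); first by rewrite divr_gt0.
rewrite -(subr0 (T x)) -zM -linearB; apply: (le_trans (Tm _)).
by rewrite mulrC -ler_pdivlMr// ltW.
Qed.

Definition ker_bop := ClosedSubspace ker_submod ker_closed.
End Kernel.

(** * Compact operators *)
Section Compactness.
Variables (R : realType).

(** The image of the unit ball under [S] is totally bounded: if [T x] and [T x']
    lie within [d] of the same point then [S x] and [S x'] are close.  Total
    boundedness is used in the form that an ultrafilter [F] on the closure of
    the image is Cauchy.  If some [P y] (the [v] near [S x] for an [x] with [T x]
    near [y]) belongs to [F], then [F] contains a small ball.  Otherwise the
    compact closure of the image of [T] is covered by balls around points [y]
    whose [P y] are all negligible for [F], and then so is their union, which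
    contains a neighbourhood of the image of [S]. *)
Lemma compact_op_dom (U V W : hilbertType R) (T : bop U V) (S : bop U W) (c : R) :
  0 <= c -> (forall x, rnorm (S x) ^+ 2 <= c * rnorm (T x) * rnorm x) ->
  compact_op T -> compact_op S.
Proof.
move=> c0 ST; rewrite /compact_op !precompactE => cT; rewrite compact_ultra => F FU FS.
pose b := [set x : U | `|x| <= 1].
have b1 x : b x -> rnorm x <= 1 by rewrite /b /= rnormE lecR.
have c1 : 0 < c + 1 by rewrite ltr_wpDl.
suff FC : cauchy F.
  have /cvg_ex[/= l Fl] : cvg F by exact: cauchy_cvg.
  exists l; split => //.
  apply: closed_closure => // B /Fl FB.
  exact: (@filter_ex _ F _ _ (filterI FS FB)).
apply/cauchyP => e' e'0; pose e := complex.Re e'.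
have e0 : 0 < e by move: e'0; rewrite ltcE => /andP[].
have e'E : e' = e%:C by rewrite RRe_real// gtr0_real.
(* With this [d], [|T (x0 - x)| <= 2 d] forces [|S (x0 - x)| <= e / 4]. *)
pose d := (e / 4) ^+ 2 / (4 * (c + 1)).
have d0 : 0 < d by rewrite divr_gt0 ?mulr_gt0// exprn_gt0// divr_gt0.
pose P (y : V) := [set v | exists x,
  [/\ b x, rnorm (y - T x) < d & rnorm (v - S x) < e / 4]].
have [[y FP]|nP] := pselect (exists y, F (P y)).
  have [v0 [x0 [bx0 yx0 vx0]]] := @filter_ex _ F _ _ FP.
  exists v0; apply: filterS FP => v [x [bx yx vx]].
  rewrite -ball_normE /= rnormE e'E ltcR.
  have Txx : rnorm (T (x0 - x)) <= 2 * d.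
    rewrite linearB -(subrKA y); apply: (le_trans (rnormD _ _)).
    by rewrite (rnormB _ y); lra.
  have xx : rnorm (x0 - x) <= 2.
    apply: (le_trans (rnormD _ _)); rewrite rnormN.
    by have := b1 _ bx; have := b1 _ bx0; lra.
  have Sxx : rnorm (S (x0 - x)) <= e / 4.
    rewrite -ler_sqr ?nnegrE ?rnorm_ge0 ?divr_ge0 ?(ltW e0)//.
    apply: (le_trans (ST _)); have -> : (e / 4) ^+ 2 = (c + 1) * (2 * d) * 2.
      by rewrite /d; field; rewrite gt_eqF.
    by rewrite ler_pM ?mulr_ge0 ?rnorm_ge0// ler_pM ?rnorm_ge0// lerDl.
  rewrite (_ : v0 - v = (v0 - S x0) + (S (x0 - x) + (S x - v))); last first.
    by rewrite linearB subrKA subrKA.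
  apply: (le_lt_trans (rnormD _ _)).
  have := rnormD (S (x0 - x)) (S x - v); rewrite (rnormB _ v); lra.
have /compact_near_coveringP ncov := cT.
have : \forall v \near F, closure (T @` b) `<=`
    (fun y => ~ exists x, [/\ b x, T x = y & rnorm (v - S x) < e / 4]).
  apply: ncov => y _; exists (ball y d%:C, ~` P y).
    split; first by apply: nbhsx_ballx; rewrite ltcR.
    have [FP|//] := in_ultra_setVsetC (P y) FU.
    by exfalso; apply: nP; exists y.
  case=> y' v [/= yy' nPv] [x [bx Txy vx]]; apply: nPv; exists x; split=> //.
  by move: yy'; rewrite -ball_normE /= rnormE ltcR Txy.
move=> Fv; have [v [vS vn]] := @filter_ex _ F _ _ (filterI FS Fv).
have [|_ [[x bx <-] vx]] := vS (ball v (e / 4)%:C).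
  by apply: nbhsx_ballx; rewrite ltcR divr_gt0.
exfalso; apply: (vn (T x)); first by apply: subset_closure; exists x.
by exists x; split => //; move: vx; rewrite -ball_normE /= rnormE ltcR.
Qed.

(** [T T^*] is compact and [|T^* x|^2 = <T T^* x, x> <= |T T^* x| |x|]. *)
Lemma schauder (H : hilbertType R) (T : bop H H) :
  compact_op T -> compact_op (adjoint T).
Proof.
move=> /(compact_op_compr (adjoint T)); apply: (@compact_op_dom _ _ _ _ _ 1) => // x /=.
by rewrite mul1r -rinner_norm -rinner_adjoint rinner_cs.
Qed.
End Compactness.

(** * The balance condition in terms of operators *)
Section Calkin.
Variables (R : realType) (H : hilbertType R).
Implicit Types A B C T : bop H H.

Lemma calkin_class_eq0 T : calkin_class T = 0 -> compact_op T.
Proof.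
rewrite /calkin_class -[0 : calkin H]/(calkin0 H) piE => /eqP/calkinP.
by rewrite subr0.
Qed.

(** [A] and the chosen representative of its class differ by a compact operator,
    whose adjoint is compact. *)
Lemma calkin_starE A : calkin_star (calkin_class A) = calkin_class (adjoint A).
Proof.
apply/eqP/calkinP; rewrite -adjointB; apply: schauder.
by apply/calkinP; rewrite reprK.
Qed.

Lemma calkin_classB A B : calkin_class (A - B) = calkin_class A - calkin_class B.
Proof. by rewrite /calkin_class !piE. Qed.

Lemma calkin_classM A B : calkin_class (A * B) = calkin_class A * calkin_class B.
Proof. by rewrite /calkin_class !piE. Qed.

Lemma calkin_class1 : calkin_class (1 : bop H H) = 1.
Proof. by rewrite /calkin_class !piE. Qed.

Lemma K_balanced_compact A B C : K_balanced A B ->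
  C \in defects (@adjoint R H) A B ->
  compact_op ((A - B) * C) /\ compact_op ((adjoint A - adjoint B) * C).
Proof.
move=> [_ _ bal] CD.
have {}CD : calkin_class C \in
    defects (@calkin_star R H) (calkin_class A) (calkin_class B).
  move: CD; rewrite /defects !calkin_starE !inE -calkin_class1 -!calkin_classM.
  by rewrite -!calkin_classB => /or4P[]/eqP ->; rewrite eqxx ?orbT.
have [c1 c2] := bal _ CD; move: c1 c2.
rewrite !calkin_starE -!calkin_classB -!calkin_classM.
by move=> /calkin_class_eq0 ? /calkin_class_eq0.
Qed.

Lemma defects_selfadjoint A B C :
  C \in defects (@adjoint R H) A B -> adjoint C = C.
Proof.
by rewrite !inE => /or4P[] /eqP ->; rewrite adjointB adjoint1 adjointM adjointK.
Qed.
End Calkin.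

(** * Absolute values of self-adjoint operators *)
Section SquareRoot.
Variables (R : realType) (H : hilbertType R).
Implicit Types (T X Y Z : bop H H).

Definition contraction T := forall x, rnorm (T x) <= rnorm x.

Lemma seq_cvg_unique (u : nat -> H) (l l' : H) :
  u n @[n --> \oo] --> l -> u n @[n --> \oo] --> l' -> l = l'.
Proof. by move=> ul ul'; apply: cvg_unique ul ul'; exact: norm_hausdorff. Qed.

Lemma contraction_limit (Y : nat -> bop H H) :
  (forall n, contraction (Y n)) ->
  (forall x, exists l : H, Y n x @[n --> \oo] --> l) ->
  exists2 L : bop H H, contraction L & forall x, Y n x @[n --> \oo] --> L x.
Proof.
move=> Y1 /choice[f fE].
have flin : linear f.
  move=> a x y; apply: (seq_cvg_unique (fE (a *: x + y))).
  have -> : (fun n => Y n (a *: x + y)) = (fun n => a *: Y n x + Y n y).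
    by apply/funext => n; rewrite (bop_linear (Y n)).
  exact: (cvgD (cvgZ (cvg_cst a) (fE x)) (fE y)).
have f1 x : rnorm (f x) <= 1 * rnorm x.
  apply/ler_addgt0Pl => e e0.
  have [N /(_ N (leqnn N)) NP] := (cvg_rnormP _ _).1 (fE x) e e0.
  rewrite mul1r -(subrK (Y N x) (f x)); apply: (le_trans (rnormD _ _)).
  by rewrite rnormB lerD ?(ltW NP)//; exact: Y1.
by exists (Bop flin (rnorm_bounded f1)) => // x; rewrite -[leRHS]mul1r; exact: f1.
Qed.

(** The operator iteration [sqrt_iter] below, run on the scalar [Z = 1].  As [Z]
    is a contraction, this scalar sequence dominates the norms of the iterates
    and of their successive differences. *)
Fixpoint sqrt_bound (n : nat) : R :=
  if n is n'.+1 then (1 + sqrt_bound n' ^+ 2) / 2 else 0.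

Lemma sqrt_bound01 n : 0 <= sqrt_bound n <= 1.
Proof.
elim: n => [|n /andP[t0 t1]] /=; first by rewrite lexx ler01.
by apply/andP; split; nra.
Qed.

Lemma sqrt_boundS n : sqrt_bound n <= sqrt_bound n.+1.
Proof. by have := sqr_ge0 (sqrt_bound n - 1); rewrite /=; nra. Qed.

Lemma sqrt_bound_cauchy (e : R) : 0 < e ->
  exists N, forall n, (N <= n)%N -> sqrt_bound n - sqrt_bound N < e.
Proof.
move=> e0; have ub : has_ubound (range sqrt_bound).
  by exists 1 => _ [n _ <-]; have /andP[] := sqrt_bound01 n.
have [|_ [N _ <-] NP] := @sup_adherent _ (range sqrt_bound) e e0.
  by split => //; exists (sqrt_bound 0), 0%N.
exists N => n Nn; have := ub_le_sup ub (ex_intro2 _ _ n I erefl).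
by lra.
Qed.

Variable Z : bop H H.
Hypotheses (Z1 : contraction Z) (Zsa : adjoint Z = Z).

(** The limit [Y] satisfies [2 Y = Z + Y Y], that is [(1 - Y)^2 = 1 - Z]. *)
Fixpoint sqrt_iter (n : nat) : bop H H :=
  if n is n'.+1 then scal_bop H 2^-1 * (Z + sqrt_iter n' * sqrt_iter n') else 0.

Lemma sqrt_iterS n x :
  sqrt_iter n.+1 x = (2^-1)%:C *: (Z x + sqrt_iter n (sqrt_iter n x)).
Proof. by []. Qed.

Lemma half_rnorm x : rnorm (scal_bop H 2^-1 x) = rnorm x / 2.
Proof. by rewrite rnormZ ger0_norm ?invr_ge0// mulrC. Qed.

Lemma sqrt_iter_le n x : rnorm (sqrt_iter n x) <= sqrt_bound n * rnorm x.
Proof.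
elim: n x => [|n IH] x; first by rewrite rnorm0 mul0r.
rewrite [sqrt_iter _ _]/= half_rnorm /=; have /andP[t0 t1] := sqrt_bound01 n.
have := rnormD (Z x) (sqrt_iter n (sqrt_iter n x)).
have := IH (sqrt_iter n x); have := ler_wpM2l t0 (IH x); have := Z1 x; lra.
Qed.

Lemma sqrt_iter_contraction n : contraction (sqrt_iter n).
Proof.
move=> x; apply: (le_trans (sqrt_iter_le n x)); rewrite ler_piMl ?rnorm_ge0//.
by have /andP[] := sqrt_bound01 n.
Qed.

(** With [Y'] the successor of [Y], the difference of the next two iterates is
    half of [Y' (Y' - Y) + (Y' - Y) Y], and the scalar sequence satisfies the
    same identity. *)
Lemma sqrt_iter_diff n x :
  rnorm (sqrt_iter n.+1 x - sqrt_iter n x) <=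
  (sqrt_bound n.+1 - sqrt_bound n) * rnorm x.
Proof.
elim: n x => [|n IH] x.
  have -> : sqrt_iter 1 x - sqrt_iter 0 x = scal_bop H 2^-1 (Z x).
    by rewrite -[RHS]subr0 /sqrt_iter mulr0 addr0.
  by rewrite half_rnorm /=; have := Z1 x; lra.
set Y' := sqrt_iter n.+1 in IH *; set Y := sqrt_iter n in IH *.
set t' := sqrt_bound n.+1 in IH *; set t := sqrt_bound n in IH *.
have -> : sqrt_iter n.+2 x - Y' x =
    scal_bop H 2^-1 (Y' (Y' x - Y x) + (Y' (Y x) - Y (Y x))).
  rewrite /Y' (sqrt_iterS n.+1) {2}(sqrt_iterS n x) -/Y -/Y' -scalerBr.
  rewrite /scal_bop [RHS]/bop_fun; congr (_ *: _).
  by rewrite linearB subrKA opprD addrACA subrr add0r.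
have -> : sqrt_bound n.+2 - t' = (t' * (t' - t) + (t' - t) * t) / 2.
  by rewrite /t' /t /=; field.
rewrite half_rnorm mulrAC ler_wpM2r ?invr_ge0// mulrDl.
apply: (le_trans (rnormD _ _)); rewrite lerD//.
  apply: (le_trans (sqrt_iter_le _ _)); rewrite -/t' -(mulrA t') ler_wpM2l//.
  by have /andP[] := sqrt_bound01 n.+1.
apply: (le_trans (IH _)); rewrite -mulrA ler_wpM2l ?sqrt_iter_le//.
by rewrite subr_ge0 sqrt_boundS.
Qed.

Lemma sqrt_iter_cvg x : exists l : H, sqrt_iter n x @[n --> \oo] --> l.
Proof.
apply: cauchy_rnorm_cvg => e e0.
have x1 : 0 < rnorm x + 1 by rewrite ltr_wpDl ?rnorm_ge0.
have [|N NP] := @sqrt_bound_cauchy (e / (rnorm x + 1)); first by rewrite divr_gt0.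
exists N => n Nn; have := NP n Nn; rewrite ltr_pdivlMr//.
apply: le_lt_trans; have le : sqrt_bound N <= sqrt_bound n /\
    rnorm (sqrt_iter n x - sqrt_iter N x) <= (sqrt_bound n - sqrt_bound N) * rnorm x.
  elim: n Nn => [|n IH]; first by rewrite leqn0 => /eqP ->; rewrite !subrr mul0r rnorm0.
  rewrite leq_eqVlt => /predU1P[<-|/IH[nN le]]; first by rewrite !subrr mul0r rnorm0.
  split; first by apply: (le_trans nN); exact: sqrt_boundS.
  rewrite -(subrKA (sqrt_iter n x)); apply: (le_trans (rnormD _ _)).
  by have := sqrt_iter_diff n x; lra.
by have [? ?] := le; have := rnorm_ge0 x; nra.
Qed.

Lemma sqrt_iter_adjoint n : adjoint (sqrt_iter n) = sqrt_iter n.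
Proof.
elim: n => [|n IH] /=.
  by apply: adjoint_unique => x y; rewrite rinner0l rinnerC rinner0l.
by rewrite adjointM adjoint_scal adjointD adjointM IH Zsa scal_bopC.
Qed.

Lemma sqrt_iter_comm n T : T * Z = Z * T -> T * sqrt_iter n = sqrt_iter n * T.
Proof.
move=> TZ; elim: n => [|n IH] /=; first by rewrite mulr0 mul0r.
by rewrite mulrA -scal_bopC -!mulrA mulrDr mulrDl TZ mulrA IH -!mulrA IH.
Qed.

(** In effect [Y = 1 - (1 - Z)^(1/2)].  The algebraic properties pass to the
    pointwise limit from the iterates, which are polynomials in [Z]. *)
Lemma sqrt_limit : exists Y, [/\ contraction Y, adjoint Y = Y,
  Y + Y = Z + Y * Y & forall T, T * Z = Z * T -> T * Y = Y * T].
Proof.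
have [Y Y1 YE] := contraction_limit sqrt_iter_contraction sqrt_iter_cvg.
have cont (S : bop H H) u l : u n @[n --> \oo] --> l -> S (u n) @[n --> \oo] --> S l.
  by move=> ul; apply: cvg_comp ul _; exact: bop_continuous.
exists Y; split => //.
- apply: adjoint_unique => x y; apply/eqP; rewrite -subr_eq0 -normr_eq0.
  apply/eqP/le_anti; rewrite normr_ge0 andbT; apply/ler_addgt0Pl => e e0; rewrite addr0.
  have k0 : 0 < 1 + rnorm x + rnorm y by have := rnorm_ge0 x; have := rnorm_ge0 y; lra.
  have d0 : 0 < e / (1 + rnorm x + rnorm y) by rewrite divr_gt0.
  have [N NP] := (cvg_rnormP _ _).1 (YE x) _ d0.
  have [N' N'P] := (cvg_rnormP _ _).1 (YE y) _ d0.
  have {NP} /ltW n1 := NP _ (leq_maxl N N').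
  have {N'P} /ltW n2 := N'P _ (leq_maxr N N').
  move: (maxn N N') n1 n2 => n n1 n2.
  have -> : rinner (Y x) y - rinner x (Y y) =
      rinner x (sqrt_iter n y - Y y) - rinner (sqrt_iter n x - Y x) y.
    by rewrite rinnerBl rinnerBr (rinner_adjoint (sqrt_iter n)) sqrt_iter_adjoint; ring.
  apply: (le_trans (ler_normB _ _)).
  have := rnorm_Cauchy_Schwarz x (sqrt_iter n y - Y y).
  have := rnorm_Cauchy_Schwarz (sqrt_iter n x - Y x) y.
  have := ler_wpM2l (rnorm_ge0 x) n2; have := ler_wpM2r (rnorm_ge0 y) n1.
  have : e / (1 + rnorm x + rnorm y) * (1 + rnorm x + rnorm y) = e.
    by rewrite divfK// gt_eqF.
  by lra.
- apply: bopP => x.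
  have dbl n : sqrt_iter n.+1 x + sqrt_iter n.+1 x =
      Z x + sqrt_iter n (sqrt_iter n x).
    rewrite sqrt_iterS -scalerDl -rmorphD /= (_ : 2^-1 + 2^-1 = 1 :> R) ?scale1r//.
    by field.
  have Ysh : sqrt_iter n.+1 x @[n --> \oo] --> Y x.
    by rewrite (cvg_shiftS (fun n => sqrt_iter n x)); exact: YE.
  have cYY : sqrt_iter n (sqrt_iter n x) @[n --> \oo] --> Y (Y x).
    apply/cvg_rnormP => e e0; have e20 : 0 < e / 2 by rewrite divr_gt0.
    have [N NP] := (cvg_rnormP _ _).1 (YE x) _ e20.
    have [N' N'P] := (cvg_rnormP _ _).1 (YE (Y x)) _ e20.
    exists (maxn N N') => n; rewrite geq_max => /andP[/NP n1 /N'P n2].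
    rewrite -(subrKA (sqrt_iter n (Y x))) -linearB.
    apply: (le_lt_trans (rnormD _ _)).
    by have := sqrt_iter_contraction n (sqrt_iter n x - Y x); lra.
  rewrite -[LHS]/(Y x + Y x) -[RHS]/(Z x + Y (Y x)).
  have h2 : sqrt_iter n.+1 x + sqrt_iter n.+1 x @[n --> \oo] --> Z x + Y (Y x).
    under eq_fun do rewrite dbl.
    exact: (cvgD (cvg_cst (Z x)) cYY).
  exact: (seq_cvg_unique (cvgD Ysh Ysh) h2).
- move=> T TZ; apply: bopP => x.
  apply: (seq_cvg_unique (cont T _ _ (YE x))).
  suff -> : (fun n => T (sqrt_iter n x)) = (fun n => sqrt_iter n (T x)) by exact: YE.
  by apply/funext => n; have /(congr1 (fun S : bop H H => S x)) := sqrt_iter_comm n TZ.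
Qed.
End SquareRoot.

(** * Spectral subspaces *)
Section Splitting.
Variables (R : realType) (H : hilbertType R).
Implicit Types (T X : bop H H).

(** [L = 1 - Y] for the limit [Y] attached to [Z = 1 - X X].  It is positive
    because [Y] is a contraction, and commutes with [X] because [Z] does. *)
Lemma abs_bop X : contraction X -> adjoint X = X ->
  exists L : bop H H, [/\ forall x, 0 <= rinner (L x) x, adjoint L = L,
    L * L = X * X & L * X = X * L].
Proof.
move=> X1 Xsa; pose Z := 1 - X * X.
have Zsa : adjoint Z = Z by rewrite adjointB adjoint1 adjointM Xsa.
have Z1 : contraction Z.
  move=> x; rewrite -ler_sqr ?nnegrE ?rnorm_ge0// /Z.
  rewrite [(_ - _ : bop H H) x]/(x - X (X x)) rnorm_sqrD rinnerNr rnormN.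
  rewrite rinnerC rinner_adjoint Xsa rinner_norm.
  have : rnorm (X (X x)) ^+ 2 <= rnorm (X x) ^+ 2 by rewrite ler_sqr ?nnegrE ?rnorm_ge0.
  by have := sqr_ge0 (rnorm (X x)); lra.
have [Y [Y1 Ysa YY Ycomm]] := sqrt_limit Z1 Zsa.
exists (1 - Y); split.
- move=> x; rewrite [(_ - _ : bop H H) x]/(x - Y x) rinnerBl rinner_norm subr_ge0 expr2.
  apply: le_trans (rinner_cs _ _) _; apply: ler_wpM2r; [exact: rnorm_ge0|exact: Y1].
- by rewrite adjointB adjoint1 Ysa.
- have -> : X * X = 1 - (Y + Y - Y * Y) by rewrite YY addrK subKr.
  by rewrite mulrBl mul1r mulrBr mulr1 -!addrA -opprD.
- have XZ : X * Z = Z * X by rewrite /Z mulrBr mulrBl mulr1 mul1r mulrA.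
  by rewrite mulrBl mulrBr mul1r mulr1 Ycomm.
Qed.

(** [M] is the kernel of [L + X], with [L] the absolute value of [X].  On [M],
    [X = - L <= 0].  For [x] orthogonal to [M], the vector [(L - X) x] lies in
    [M] because [(L + X) (L - X) = 0], and is orthogonal to [M] because [L - X]
    is self-adjoint and preserves [M]; so it vanishes and [X x = L x]. *)
Lemma sign_splitting_contraction X : contraction X -> adjoint X = X ->
  exists M : closedSubspace H, [/\
    (forall x, x \in subspace_pred M -> X x \in subspace_pred M),
    (forall x, x \in subspace_pred M -> rinner (X x) x <= 0) &
    (forall x, x \in subspace_pred (ortho M) -> 0 <= rinner (X x) x)].
Proof.
move=> X1 Xsa; have [L [L0 Lsa LL LX]] := abs_bop X1 Xsa.
exists (ker_bop (L + X)).
have kerP x : x \in subspace_pred (ker_bop (L + X)) -> L x + X x = 0 by move=> /eqP.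
have inv T x : T * (L + X) = (L + X) * T ->
    x \in subspace_pred (ker_bop (L + X)) -> T x \in subspace_pred (ker_bop (L + X)).
  move=> /(congr1 (fun S : bop H H => S x)) /= TLX /kerP k; apply/eqP => /=.
  by rewrite -TLX k linear0.
have PN : (L + X) * (L - X) = 0 by rewrite mulrDl !mulrBr LL LX subrKA subrr.
have NP : (L - X) * (L + X) = 0.
  by rewrite mulrBl !mulrDr LL LX (addrC (X * X)) subrr.
split.
- by move=> x; apply: inv; rewrite mulrDl mulrDr LX.
- by move=> x /kerP/eqP; rewrite addrC addr_eq0 => /eqP ->; rewrite rinnerNl oppr_le0.
move=> x /orthoP xM; suff : (L - X) x = 0.
  by move=> /eqP; rewrite subr_eq0 => /eqP <-.
apply: (@ortho_self _ _ (ker_bop (L + X))).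
  by apply/eqP; change (((L + X) * (L - X)) x = 0); rewrite PN.
apply/orthoP => y yM; rewrite rinner_adjoint adjointB Lsa Xsa; apply: xM.
by apply: inv yM; rewrite NP PN.
Qed.

End Splitting.

Section SpectralSplitting.
Variables (R : realType) (H : hilbertType R).
Implicit Types (T : bop H H) (D : orthodecomp H).

(** The sign splitting of [T - delta], scaled down to a contraction. *)
Lemma spectral_splitting T (delta : R) : adjoint T = T ->
  exists M : closedSubspace H, [/\
    (forall x, x \in subspace_pred M -> T x \in subspace_pred M),
    (forall x, x \in subspace_pred M -> rinner (T x) x <= delta * rnorm x ^+ 2) &
    (forall x, x \in subspace_pred (ortho M) -> delta * rnorm x ^+ 2 <= rinner (T x) x)].
Proof.
move=> Tsa; have [m m0 Tm] := bop_rnorm (T - scal_bop H delta).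
pose X := scal_bop H m^-1 * (T - scal_bop H delta).
have XE x : X x = (m^-1)%:C *: (T x - delta%:C *: x) by [].
have Xip x : m * rinner (X x) x = rinner (T x) x - delta * rnorm x ^+ 2.
  by rewrite XE rinnerZl mulVKf ?gt_eqF// rinnerBl rinnerZl rinner_norm.
have X1 : contraction X.
  move=> x; rewrite XE rnormZ gtr0_norm ?invr_gt0// mulrC ler_pdivrMr// mulrC.
  exact: Tm.
have Xsa : adjoint X = X.
  by rewrite adjointM adjointB !adjoint_scal Tsa -scal_bopC.
have [M [MX Xle Xge]] := sign_splitting_contraction X1 Xsa; exists M; split.
- move=> x xM; have -> : T x = m%:C *: X x + delta%:C *: x.
    by rewrite XE scalerA -rmorphM /= divff ?gt_eqF// scale1r subrK.
  apply: subspace_linear; first exact: MX.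
  rewrite -[X in X \in _]addr0; apply: subspace_linear => //; exact: subspace0.
- by move=> x /Xle Xx; rewrite -subr_le0 -Xip pmulr_rle0.
- by move=> x /Xge Xx; rewrite -subr_ge0 -Xip pmulr_rge0.
Qed.

Lemma rinner_component D i x (z : subspace_type (summand D i)) :
  rinner (component D i x) z = rinner x (val z).
Proof. by rewrite /rinner -inner_component. Qed.

Lemma rnorm_component D i x : rnorm (component D i x) <= rnorm x.
Proof.
have [->|p0] := eqVneq (rnorm (component D i x)) 0; first exact: rnorm_ge0.
have pp : 0 < rnorm (component D i x) by rewrite lt_def p0 rnorm_ge0.
by rewrite -(ler_pM2r pp) -expr2 -rinner_norm rinner_component rinner_cs.
Qed.

Lemma component_val D i (x : subspace_type (summand D i)) :
  component D i (val x) = x.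
Proof.
apply/subr0_eq/rnorm_eq0/eqP; rewrite -sqrf_eq0 -rinner_norm rinnerBl.
by rewrite rinner_component subrr.
Qed.

Lemma adjoint_projection D i :
  adjoint (bop_comp (Defs.incl (summand D i)) (Defs.proj D i)) =
  bop_comp (Defs.incl (summand D i)) (Defs.proj D i).
Proof.
apply: adjoint_unique => x y /=.
by rewrite -(rinner_component x) rinnerC -rinner_component rinnerC.
Qed.

End SpectralSplitting.

(** * Entries with respect to a spectral decomposition *)
Section OrthoDecomposition.
Variables (R : realType) (H : hilbertType R) (M : closedSubspace H).
Implicit Types C S T : bop H H.
Local Notation D := (ortho_decomp M).

(** Only the component [p] of [x] contributes to [<T x, p>], since [T] maps [M]
    to [M], which is orthogonal to [p]; so [delta |p|^2 <= <T x, p>]. *)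
Lemma rnorm_component_ortho T (delta : R) :
  (forall x, x \in subspace_pred M -> T x \in subspace_pred M) ->
  (forall x, x \in subspace_pred (ortho M) -> delta * rnorm x ^+ 2 <= rinner (T x) x) ->
  forall x, delta * rnorm (component D ord0 x) <= rnorm (T x).
Proof.
move=> MT Tge x; set p := component D ord0 x.
have [p0|p0] := eqVneq (rnorm p) 0; first by rewrite p0 mulr0 rnorm_ge0.
have pp : 0 < rnorm p by rewrite lt_def p0 rnorm_ge0.
have pM : val p \in subspace_pred (ortho M) := valP p.
rewrite -(ler_pM2r pp) -mulrA -expr2; apply: (le_trans (Tge _ pM)).
suff -> : rinner (T (val p)) (val p) = rinner (T x) (val p) by exact: rinner_cs.
pose q := component D ord_max x.
have qM : val q \in subspace_pred M := valP q.
have -> : x = val p + val q.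
  have last_ord : lift ord0 ord0 = ord_max :> 'I_2 by exact: val_inj.
  by rewrite {1}(componentE D x) big_ord_recl big_ord1 last_ord.
rewrite linearD rinnerDl [X in _ + X]rinnerC.
by have /orthoP -> := pM; [rewrite addr0|exact: MT].
Qed.

Lemma compact_component_ortho T C (delta : R) : 0 < delta ->
  (forall x, delta * rnorm (component D ord0 x) <= rnorm (T x)) ->
  compact_op (T * C) -> compact_op (bop_comp (Defs.proj D ord0) C).
Proof.
move=> delta0 Tge; have [m m0 Cm] := bop_rnorm C.
apply: (@compact_op_dom _ _ _ _ _ _ (m / delta)) => [|x /=].
  by rewrite divr_ge0 ?ltW.
have := Tge (C x); have := rnorm_component D ord0 (C x).
have := Cm x; set p := rnorm (component _ _ _); set t := rnorm (T _).
move=> h1 h2 h3; rewrite expr2.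
have -> : m / delta * t * rnorm x = (t / delta) * (m * rnorm x) by field; rewrite gt_eqF.
have p0 : 0 <= p := rnorm_ge0 _.
apply: ler_pM => //; last exact: le_trans h2 h1.
by rewrite ler_pdivlMr// mulrC.
Qed.

(** With [P_1] the projection on the first summand, the entry from the first
    summand to the second factors through [C P_1], the adjoint of [P_1 C]. *)
Lemma compact_entry C (i j : 'I_2) : adjoint C = C ->
  compact_op (bop_comp (Defs.proj D ord0) C) -> (i, j) != (ord_max, ord_max) ->
  compact_op (entry D C i j).
Proof.
move=> Csa cC ij; have [i0|i0] := eqVneq i ord0.
  by rewrite i0; exact: (compact_op_compr (Defs.incl _) cC).
have -> : j = ord0.
  by case: i j i0 ij => [[|[|//]] ?] [[|[|//]] ?] i0 ij; apply: val_inj.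
pose F := bop_comp (Defs.incl (summand D ord0)) (Defs.proj D ord0).
have cCF : compact_op (C * F).
  have -> : C * F = adjoint (F * C) by rewrite adjointM Csa adjoint_projection.
  apply: schauder; have -> : F * C = bop_comp (Defs.incl _) (bop_comp (Defs.proj D ord0) C).
    exact: bopP.
  exact: compact_op_compl.
have -> : entry D C i ord0 =
    bop_comp (bop_comp (Defs.proj D i) (C * F)) (Defs.incl (summand D ord0)).
  by apply: bopP => x /=; rewrite component_val.
by apply: compact_op_compr; exact: compact_op_compl.
Qed.

(** An entry with source [M] is bounded by [S]; the remaining entry, with source
    the complement and target [M], is the adjoint of one with source [M]. *)
Lemma opnorm_entry S (d : R) (i j : 'I_2) : 0 <= d ->
  (forall x, x \in subspace_pred M -> rnorm (S x) <= d * rnorm x) ->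
  (forall x, x \in subspace_pred M -> rnorm (adjoint S x) <= d * rnorm x) ->
  (i, j) != (ord0, ord0) -> opnorm (entry D S i j) <= d.
Proof.
move=> d0 Sd Sd' ij; have memM k (x : subspace_type (summand D k)) :
    k != ord0 -> val x \in subspace_pred M.
  move=> k0; have sub z : z \in subspace_pred (summand D k) -> z \in subspace_pred M.
    by rewrite /= /ortho_summand (negPf k0).
  exact: sub (valP x).
apply: opnorm_le => // x; have [j0|j0] := eqVneq j ord0; last first.
  by apply: (le_trans (rnorm_component _ _ _)); apply: Sd; exact: memM.
have i0 : i != ord0 by apply: contraNneq ij => ->; rewrite j0.
pose p := component D i (S (val x)); rewrite -[entry D S i j x]/p.
have [p0|p0] := eqVneq (rnorm p) 0; first by rewrite p0 mulr_ge0 ?rnorm_ge0.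
have pp : 0 < rnorm p by rewrite lt_def p0 rnorm_ge0.
rewrite -(ler_pM2r pp) -expr2 -rinner_norm {1}/p rinner_component rinner_adjoint.
apply: (le_trans (rinner_cs _ _)); rewrite mulrAC mulrC.
by apply: ler_wpM2r; [exact: rnorm_ge0|apply: Sd'; exact: memM].
Qed.

End OrthoDecomposition.

Lemma le_of_sqrD_le (R : realType) (s t d r : R) : 0 <= d -> 0 <= r -> 0 <= s ->
  s ^+ 2 + t ^+ 2 <= d ^+ 2 * r ^+ 2 -> s <= d * r.
Proof.
move=> d0 r0 s0 st; rewrite -ler_sqr ?nnegrE ?mulr_ge0// exprMn.
by apply: le_trans st; rewrite lerDl sqr_ge0.
Qed.

Theorem theorem5p2 (R : realType) (H : hilbertType R) (A B : bop H H)
    (balAB : K_balanced A B) (eps : R) (eps_gt0 : 0 < eps) :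
  exists D : orthodecomp H,
    (forall i j : 'I_2, (i, j) != (ord0, ord0) ->
       opnorm (entry D A i j - entry D B i j) < eps) /\
    (forall C : bop H H, C \in defects (@adjoint R H) A B ->
     forall i j : 'I_2, (i, j) != (ord_max, ord_max) ->
       exists E K : bop (subspace_type (summand D j))
                        (subspace_type (summand D i)),
         [/\ entry D C i j = E + K, opnorm E < eps & compact_op K]).
Proof.
pose S := A - B; pose T := adjoint S * S + S * adjoint S.
have Tsa : adjoint T = T by rewrite adjointD !adjointM adjointK.
have Tip x : rinner (T x) x = rnorm (S x) ^+ 2 + rnorm (adjoint S x) ^+ 2.
  rewrite [T x]/(adjoint S (S x) + S (adjoint S x)) rinnerDl -!rinner_norm.
  by rewrite [X in X + _]rinnerC -rinner_adjoint [X in _ + X]rinner_adjoint.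
pose d := eps / 2; have d0 : 0 < d by rewrite divr_gt0.
have deps : d < eps by rewrite /d; lra.
have [M [MT Tle Tge]] := spectral_splitting (d ^+ 2) Tsa.
exists (ortho_decomp M); split=> [i j ij|C CD i j ij].
  apply: le_lt_trans deps.
  have -> : entry (ortho_decomp M) A i j - entry (ortho_decomp M) B i j =
      entry (ortho_decomp M) S i j.
    apply: bopP => x.
    by rewrite /= -[RHS]/(Defs.proj (ortho_decomp M) i (A (val x) - B (val x))) linearB.
  apply: opnorm_entry ij => [|x /Tle|x /Tle]; rewrite ?(ltW d0)// Tip.
    by apply: le_of_sqrD_le; rewrite ?rnorm_ge0 ?(ltW d0).
  by rewrite addrC; apply: le_of_sqrD_le; rewrite ?rnorm_ge0 ?(ltW d0).
exists 0, (entry (ortho_decomp M) C i j); split; first by rewrite add0r.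
  apply: le_lt_trans eps_gt0; apply: opnorm_le => // x.
  by rewrite mul0r rnorm0.
apply: compact_entry => //; first exact: defects_selfadjoint CD.
apply: (@compact_component_ortho _ _ _ T C (d ^+ 2)); first by rewrite exprn_gt0.
  exact: rnorm_component_ortho.
have [c1 c2] := K_balanced_compact balAB CD.
rewrite mulrDl -!mulrA; apply: compact_opD; apply: compact_op_compl => //.
by rewrite adjointB.
Qed.
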